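(* Let $(A,\nu,\alpha)$ be a regular Hom-pre-Lie algebra over a field $\mathbb{K}$ of characteristic zero and let $(\nu_t,\alpha_t)$ be a deformation of order $n$ of $A$. Then $(\nu_t,\alpha_t)$ is extendable to a deformation of order $n+1$ if and only if the cohomology class of the obstruction $O^n(A)=(O^n_\nu(A),O^n_\alpha(A))\in\widetilde C^3(A,A)$ vanishes.
   Context: $\mathbb{K}$ is a field of characteristic zero. A Hom-pre-Lie algebra $(A,\nu,\alpha)$, $\nu(a,b)=a\cdot b$, is a $\mathbb{K}$-vector space $A$ with a bilinear product $\cdot$ and a linear map $\alpha:A\to A$ such that for all $a,b,c\in A$: $(a\cdot b)\cdot\alpha(c)-\alpha(a)\cdot(b\cdot c)=(b\cdot a)\cdot\alpha(c)-\alpha(b)\cdot(a\cdot c)$ and $\alpha(a\cdot b)=\alpha(a)\cdot\alpha(b)$. It is regular if $\alpha$ is invertible (standing assumption). A deformation of order $n$ of $A$ is a pair $\nu_t=\sum_{i=0}^n\nu_it^i$, $\alpha_t=\sum_{i=0}^n\alpha_it^i$, with $\nu_i:A\times A\to A$ $\mathbb{K}$-bilinear, $\alpha_i:A\to A$ $\mathbb{K}$-linear (extended $\mathbb{K}[[t]]$-(bi)linearly to $A[[t]]$), $\nu_0=\nu$, $\alpha_0=\alpha$, such that for all $a,b,c\in A$, modulo $t^{n+1}$: $\nu_t(\nu_t(a,b),\alpha_t(c))-\nu_t(\alpha_t(a),\nu_t(b,c))=\nu_t(\nu_t(b,a),\alpha_t(c))-\nu_t(\alpha_t(b),\nu_t(a,c))$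 and $\nu_t(\alpha_t(a),\alpha_t(b))=\alpha_t(\nu_t(a,b))$. It is extendable to a deformation of order $n+1$ if there exist a bilinear $\nu_{n+1}:A\times A\to A$ and a linear $\alpha_{n+1}:A\to A$ such that $(\nu_t+\nu_{n+1}t^{n+1},\ \alpha_t+\alpha_{n+1}t^{n+1})$ satisfies these two identities modulo $t^{n+2}$. For bilinear $\nu_i,\nu_k$ and linear $\alpha_j$ put $(\nu_i\circ_{\alpha_j}\nu_k)(a,b,c)=\nu_i(\nu_k(a,b),\alpha_j(c))-\nu_i(\alpha_j(a),\nu_k(b,c))$. The obstruction is $$O^n_\nu(A)(a,b,c)=\sum_{\substack{i+j+k=n+1\\0\le i,j,k\le n}}(\nu_i\circ_{\alpha_j}\nu_k)(a,b,c)-\sum_{\substack{i+j+k=n+1\\0\le i,j,k\le n}}(\nu_i\circ_{\alpha_j}\nu_k)(b,a,c),$$ $$O^n_\alpha(A)(a,b)=\sum_{\substack{i+j+k=n+1\\0\le i,j,k\le n}}\nu_i(\alpha_j(a),\alpha_k(b))-\sum_{\substack{i+j=n+1\\0\le i,j\le n}}\alpha_i(\nu_j(a,b)).$$ $\alpha$-type cochains of $A$ with coefficients in itself: $\widetilde C^2(A,A)=\mathrm{Hom}(A^{\otimes2},A)\oplus\mathrm{Hom}(A,A)$, $\widetilde C^3(A,A)=\mathrm{Hom}(A^{\otimes3},A)\oplus\mathrm{Hom}(A^{\otimes2},A)$; $\widetilde\partial:\widetilde C^2(A,A)\to\widetilde C^3(A,A)$ is $\widetilde\partial(\varphi,\psi)=(\widetilde\partial_{\nu\nu}\varphi-\widetilde\partial_{\alpha\nu}\psi,\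 \widetilde\partial_{\nu\alpha}\varphi-\widetilde\partial_{\alpha\alpha}\psi)$, where $(\widetilde\partial_{\nu\nu}\varphi)(a,b,c)=\alpha(a)\cdot\varphi(b,c)-\alpha(b)\cdot\varphi(a,c)+\varphi(b,a)\cdot\alpha(c)-\varphi(a,b)\cdot\alpha(c)-\varphi(\alpha(b),a\cdot c)+\varphi(\alpha(a),b\cdot c)-\varphi(a\cdot b,\alpha(c))+\varphi(b\cdot a,\alpha(c))$; $(\widetilde\partial_{\alpha\nu}\psi)(a,b,c)=\psi(b)\cdot(a\cdot c)-\psi(a)\cdot(b\cdot c)+(a\cdot b)\cdot\psi(c)-(b\cdot a)\cdot\psi(c)$; $(\widetilde\partial_{\nu\alpha}\varphi)(a,b)=\alpha(\varphi(a,b))-\varphi(\alpha(a),\alpha(b))$; $(\widetilde\partial_{\alpha\alpha}\psi)(a,b)=\alpha(a)\cdot\psi(b)+\psi(a)\cdot\alpha(b)-\psi(a\cdot b)$. ''The cohomology class of $O^n(A)$ vanishes'' means that $O^n(A)=\widetilde\partial(\varphi,\psi)$ for some $2$-cochain $(\varphi,\psi)\in\widetilde C^2(A,A)$. *)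

(* Defs.v *)
From HB Require Import structures.
From mathcomp Require Import all_boot all_algebra.
From mathcomp Require Import sesquilinear.

Set Implicit Arguments.
Unset Strict Implicit.
Unset Printing Implicit Defensive.
Import GRing.Theory.
Local Open Scope ring_scope.

Section LinearClosure.
Variables (K : fieldType) (U V : lmodType K).

Lemma linear_add (f g : U -> V) :
  linear f -> linear g -> linear (fun x => f x + g x).
Proof. by move=> fL gL k x y; rewrite fL gL scalerDr addrACA. Qed.

Lemma linear_opp (f : U -> V) : linear f -> linear (fun x => - f x).
Proof. by move=> fL k x y; rewrite fL opprD scalerN. Qed.

Lemma linear_bigsum (I : finType) (P : pred I) (F : I -> U -> V) :
  (forall i, linear (F i)) -> linear (fun x => \sum_(i | P i) F i x).
Proof.
move=> FL k x y; rewrite scaler_sumr -big_split /=.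
by apply: eq_bigr => i _; rewrite FL.
Qed.

End LinearClosure.

Ltac linear_sum_tac :=
  repeat first
    [ apply: linear_bigsum => ?
    | apply: linear_add
    | apply: linear_opp
    | by move=> ? ? ?; rewrite /= ?(linearP, linearPr, linearPl) ].

Section HomPreLie.
Variables (K : fieldType) (A : lmodType K).

Definition is_hom_pre_lie (nu : A -> A -> A) (alpha : A -> A) : Prop :=
  (forall a b c,
     nu (nu a b) (alpha c) - nu (alpha a) (nu b c)
     = nu (nu b a) (alpha c) - nu (alpha b) (nu a c)) /\
  (forall a b, alpha (nu a b) = nu (alpha a) (alpha b)).

Definition is_regular_hom_pre_lie (nu : A -> A -> A) (alpha : A -> A) : Prop :=
  is_hom_pre_lie nu alpha /\ bijective alpha.

(* An element x of A[[t]] is the sequence of its coefficients; nat -> A -> A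
   and nat -> A -> A -> A are formal power series of maps. *)

Definition const_series (a : A) : nat -> A :=
  fun m => if m == 0%N then a else 0.

(* The K[[t]]-linear, resp. K[[t]]-bilinear, maps on A[[t]] induced by
   alpha_t = \sum_i alpha_i t^i, resp. nu_t = \sum_i nu_i t^i. *)
Definition series_app1 (alphat : nat -> A -> A) (x : nat -> A) : nat -> A :=
  fun m => \sum_(i < m.+1) \sum_(j < m.+1 | (i + j == m)%N) alphat i (x j).

Definition series_app2 (nut : nat -> A -> A -> A) (x y : nat -> A) : nat -> A :=
  fun m => \sum_(i < m.+1) \sum_(j < m.+1)
             \sum_(k < m.+1 | (i + j + k == m)%N) nut i (x j) (y k).

Definition series_sub (x y : nat -> A) : nat -> A := fun m => x m - y m.

Definition eq_mod_t (N : nat) (x y : nat -> A) : Prop :=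
  forall m, (m < N)%N -> x m = y m.

Definition hom_pre_lie_mod (N : nat)
    (nut : nat -> A -> A -> A) (alphat : nat -> A -> A) : Prop :=
  let NU := series_app2 nut in
  let AL := series_app1 alphat in
  (forall a b c : A,
     let x := const_series a in
     let y := const_series b in
     let z := const_series c in
     eq_mod_t N
       (series_sub (NU (NU x y) (AL z)) (NU (AL x) (NU y z)))
       (series_sub (NU (NU y x) (AL z)) (NU (AL y) (NU x z)))) /\
  (forall a b : A,
     let x := const_series a in
     let y := const_series b in
     eq_mod_t N (NU (AL x) (AL y)) (AL (NU x y))).

(* \sum_(i <= n) alpha_i t^i and \sum_(i <= n) nu_i t^i as power series. *)
Definition poly_series1 n (alpha_ : 'I_n.+1 -> {linear A -> A}) :
    nat -> A -> A :=
  fun m a => \sum_(i < n.+1 | i == m :> nat) alpha_ i a.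

Definition poly_series2 n (nu_ : 'I_n.+1 -> {bilinear A -> A -> A}) :
    nat -> A -> A -> A :=
  fun m a b => \sum_(i < n.+1 | i == m :> nat) nu_ i a b.

Definition is_deformation n
    (nu : {bilinear A -> A -> A}) (alpha : {linear A -> A})
    (nu_ : 'I_n.+1 -> {bilinear A -> A -> A})
    (alpha_ : 'I_n.+1 -> {linear A -> A}) : Prop :=
  [/\ nu_ ord0 =2 nu, alpha_ ord0 =1 alpha
    & hom_pre_lie_mod n.+1 (poly_series2 nu_) (poly_series1 alpha_)].

Definition add_term1 (alphat : nat -> A -> A) N (alpha' : A -> A) :
    nat -> A -> A :=
  fun m a => alphat m a + (if m == N then alpha' a else 0).

Definition add_term2 (nut : nat -> A -> A -> A) N (nu' : A -> A -> A) :
    nat -> A -> A -> A :=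
  fun m a b => nut m a b + (if m == N then nu' a b else 0).

Definition is_extendable n
    (nu_ : 'I_n.+1 -> {bilinear A -> A -> A})
    (alpha_ : 'I_n.+1 -> {linear A -> A}) : Prop :=
  exists (nu' : {bilinear A -> A -> A}) (alpha' : {linear A -> A}),
    hom_pre_lie_mod n.+2 (add_term2 (poly_series2 nu_) n.+1 nu')
                         (add_term1 (poly_series1 alpha_) n.+1 alpha').

(* Hom(A^{(x)3}, A) is encoded by trilinear maps. *)
Definition is_trilinear (f : A -> A -> A -> A) : Prop :=
  [/\ forall b c, linear (fun a => f a b c),
      forall a c, linear (fun b => f a b c)
    & forall a b, linear (fun c => f a b c)].

Record trilinear := Trilinear {
  trilinear_fun :> A -> A -> A -> A;
  trilinearP : is_trilinear trilinear_fun }.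

Definition cochain2 : Type := ({bilinear A -> A -> A} * {linear A -> A})%type.
Definition cochain3 : Type := (trilinear * {bilinear A -> A -> A})%type.

Definition eq_cochain3 (F G : cochain3) : Prop :=
  (forall a b c, F.1 a b c = G.1 a b c) /\ (forall a b, F.2 a b = G.2 a b).

Section Differential.
Variables (nu : {bilinear A -> A -> A}) (alpha : {linear A -> A}).
Variables (phi : {bilinear A -> A -> A}) (psi : {linear A -> A}).

Definition d_nunu (a b c : A) : A :=
  nu (alpha a) (phi b c) - nu (alpha b) (phi a c)
  + nu (phi b a) (alpha c) - nu (phi a b) (alpha c)
  - phi (alpha b) (nu a c) + phi (alpha a) (nu b c)
  - phi (nu a b) (alpha c) + phi (nu b a) (alpha c).

Definition d_alphanu (a b c : A) : A :=
  nu (psi b) (nu a c) - nu (psi a) (nu b c)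
  + nu (nu a b) (psi c) - nu (nu b a) (psi c).

Definition d_nualpha (a b : A) : A :=
  alpha (phi a b) - phi (alpha a) (alpha b).

Definition d_alphaalpha (a b : A) : A :=
  nu (alpha a) (psi b) + nu (psi a) (alpha b) - psi (nu a b).

Definition d_nu (a b c : A) : A := d_nunu a b c - d_alphanu a b c.
Definition d_alpha (a b : A) : A := d_nualpha a b - d_alphaalpha a b.

Lemma d_nu_trilinear : is_trilinear d_nu.
Proof. by split=> ? ?; rewrite /d_nu /d_nunu /d_alphanu; linear_sum_tac. Qed.

Lemma d_alpha_bilinear :
  bilinear_for (GRing.Scale.Law.clone _ _ *:%R _)
               (GRing.Scale.Law.clone _ _ *:%R _) d_alpha.
Proof. by split=> ?; rewrite /d_alpha /d_nualpha /d_alphaalpha; linear_sum_tac. Qed.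

HB.instance Definition _ :=
  bilinear_isBilinear.Build K A A A _ _ d_alpha d_alpha_bilinear.

End Differential.

Definition differential2 (nu : {bilinear A -> A -> A}) (alpha : {linear A -> A})
    (c : cochain2) : cochain3 :=
  (Trilinear (d_nu_trilinear nu alpha c.1 c.2),
   d_alpha nu alpha c.1 c.2 : {bilinear A -> A -> A}).

Definition class_vanishes (nu : {bilinear A -> A -> A})
    (alpha : {linear A -> A}) (F : cochain3) : Prop :=
  exists c : cochain2, eq_cochain3 F (differential2 nu alpha c).

Definition circ (f : A -> A -> A) (g : A -> A) (h : A -> A -> A)
    (a b c : A) : A :=
  f (h a b) (g c) - f (g a) (h b c).

Section Obstruction.
Variables (n : nat) (nu_ : 'I_n.+1 -> {bilinear A -> A -> A}).
Variable alpha_ : 'I_n.+1 -> {linear A -> A}.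

Definition obstruction_nu (a b c : A) : A :=
  \sum_(i < n.+1) \sum_(j < n.+1) \sum_(k < n.+1 | (i + j + k == n.+1)%N)
    circ (nu_ i) (alpha_ j) (nu_ k) a b c
  - \sum_(i < n.+1) \sum_(j < n.+1) \sum_(k < n.+1 | (i + j + k == n.+1)%N)
    circ (nu_ i) (alpha_ j) (nu_ k) b a c.

Definition obstruction_alpha (a b : A) : A :=
  \sum_(i < n.+1) \sum_(j < n.+1) \sum_(k < n.+1 | (i + j + k == n.+1)%N)
    nu_ i (alpha_ j a) (alpha_ k b)
  - \sum_(i < n.+1) \sum_(j < n.+1 | (i + j == n.+1)%N)
    alpha_ i (nu_ j a b).

Lemma obstruction_nu_trilinear : is_trilinear obstruction_nu.
Proof. by split=> ? ?; rewrite /obstruction_nu /circ; linear_sum_tac. Qed.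

Lemma obstruction_alpha_bilinear :
  bilinear_for (GRing.Scale.Law.clone _ _ *:%R _)
               (GRing.Scale.Law.clone _ _ *:%R _) obstruction_alpha.
Proof. by split=> ?; rewrite /obstruction_alpha; linear_sum_tac. Qed.

HB.instance Definition _ :=
  bilinear_isBilinear.Build K A A A _ _ obstruction_alpha
    obstruction_alpha_bilinear.

Definition obstruction : cochain3 :=
  (Trilinear obstruction_nu_trilinear,
   obstruction_alpha : {bilinear A -> A -> A}).

End Obstruction.

End HomPreLie.

(* Main.v *)
Require Import Defs.
From HB Require Import structures.
From mathcomp Require Import all_boot all_algebra.
From mathcomp Require Import sesquilinear.

Set Implicit Arguments.
Unset Strict Implicit.
Unset Printing Implicit Defensive.
Import GRing.Theory.
Local Open Scope ring_scope.

(** The Hom-pre-Lie identity and the multiplicativity identity for a pair of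
    power series (nu_t, alpha_t) hold modulo t^p exactly when their
    coefficients of degree m < p vanish on elements of A; these coefficients
    are convolution sums over i + j + k = m, respectively i + j = m
    ([hom_pre_lie_modP]).

    Adding terms nu' and alpha' of degree n + 1 does not touch the coefficients
    of degree at most n, which vanish because the given pair is a deformation of
    order n.  So extendability by (nu', alpha') is one condition, in degree
    n + 1.  In a convolution sum of that degree an index can equal n + 1 only
    if all the others are 0.  The terms with all indices at most n form the
    obstruction.  The remaining ones involve one factor nu' or alpha' and
    otherwise only nu = nu_0 and alpha = alpha_0, so they are linear in
    (nu', alpha'), and they add up to minus the differential of this 2-cochain.
    Hence the coefficient of degree n + 1 is
      O^n(A) - d(nu', alpha')
    ([top_coef]), and (nu', alpha') extends the deformation if and only if the
    obstruction is the coboundary of (nu', alpha'). *)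

(** * Convolution sums and their outermost layer *)

(** The bound p on the indices is kept apart from the degree m: p = m + 1 gives
    a full Cauchy product coefficient, whereas p = m leaves out the terms in
    which one index is m, which is the range of the obstruction when
    m = n + 1. *)
Definition sum3 (V : zmodType) (p m : nat) (F : nat -> nat -> nat -> V) : V :=
  \sum_(i < p) \sum_(j < p) \sum_(k < p | (i + j + k == m)%N) F i j k.

Definition sum2 (V : zmodType) (p m : nat) (F : nat -> nat -> V) : V :=
  \sum_(i < p) \sum_(j < p | (i + j == m)%N) F i j.

Lemma sum_only0 (V : zmodType) (m : nat) (F : nat -> V) :
  \sum_(i < m.+1) (if i == 0%N :> nat then F i else 0) = F 0%N.
Proof. by rewrite big_ord_recl /= big1 ?addr0. Qed.

Lemma last_layer1 (V : zmodType) (s m : nat) (F : nat -> V) :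
  \sum_(k < m.+1 | (s + k == m)%N) F k =
  \sum_(k < m | (s + k == m)%N) F k + (if s == 0%N then F m else 0).
Proof.
rewrite big_mkcond big_ord_recr /= -big_mkcond /=; congr (_ + _).
by rewrite -[X in (_ == X)%N]add0n eqn_add2r.
Qed.

Lemma sum_saturated (V : zmodType) (m : nat) (F : nat -> V) :
  \sum_(k < m.+1 | (m + k == m)%N) F k = F 0%N.
Proof.
rewrite -(sum_only0 m) -big_mkcond.
by apply: eq_bigl => k; rewrite -[X in _ == X]addn0 eqn_add2l.
Qed.

(** The offset s stands for a first index held fixed: s = 0 is the double
    convolution itself, while for s > 0 no index can reach m + 1, so that the
    two ranges contribute the same terms. *)
Lemma last_layer2 (V : zmodType) (s m : nat) (F : nat -> nat -> V) :
  \sum_(j < m.+2) \sum_(k < m.+2 | (s + j + k == m.+1)%N) F j k =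
  \sum_(j < m.+1) \sum_(k < m.+1 | (s + j + k == m.+1)%N) F j k
  + (if s == 0%N then F 0%N m.+1 + F m.+1 0%N else 0).
Proof.
rewrite big_ord_recr /=.
under eq_bigr => j _ do rewrite last_layer1 addn_eq0.
rewrite big_split /= -addrA; congr (_ + _).
have [->|s_n0] := eqVneq s 0%N.
  by rewrite (sum_only0 _ (fun j => F j m.+1)) add0n sum_saturated.
(* Both boundary contributions vanish, as s + (m + 1) + k > m + 1. *)
rewrite big1 // add0r big_pred0 // => k; apply/negbTE.
by rewrite neq_ltn -addnA addnC -addSn -[X in (X < _)%N]addn0 orbC -addnA
  ltn_add2l lt0n addn_eq0 negb_and s_n0 orbT.
Qed.

Lemma sum2_last_layer (V : zmodType) (m : nat) (F : nat -> nat -> V) :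
  sum2 m.+2 m.+1 F = sum2 m.+1 m.+1 F + (F 0%N m.+1 + F m.+1 0%N).
Proof. exact: (last_layer2 0). Qed.

(** Three nonnegative indices of sum m + 1 > 0, one of which is m + 1, form one
    of the triples (0, 0, m + 1), (0, m + 1, 0), (m + 1, 0, 0); as m + 1 is not
    0, these are distinct and none is counted twice. *)
Lemma sum3_last_layer (V : zmodType) (m : nat) (F : nat -> nat -> nat -> V) :
  sum3 m.+2 m.+1 F =
  sum3 m.+1 m.+1 F + (F 0%N 0%N m.+1 + F 0%N m.+1 0%N + F m.+1 0%N 0%N).
Proof.
rewrite /sum3 big_ord_recr /=.
under eq_bigr => i _ do rewrite (last_layer2 i _ (F i)).
rewrite big_split /=.
rewrite (sum_only0 _ (fun i => F i 0%N m.+1 + F i m.+1 0%N)) -!addrA.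
do 3!congr (_ + _).
rewrite big_ord_recl /= addn0 sum_saturated big1 ?addr0 // => j _.
rewrite big_pred0 // => k; apply/negbTE.
by rewrite -[X in _ != X]addn0 -addnA eqn_add2l.
Qed.

Lemma eq_sum2 (V : zmodType) (p m : nat) (F G : nat -> nat -> V) :
  (forall i j, (i < p)%N -> (j < p)%N -> F i j = G i j) ->
  sum2 p m F = sum2 p m G.
Proof. by move=> eFG; do 2!apply: eq_bigr => ? _; exact: eFG. Qed.

Lemma eq_sum3 (V : zmodType) (p m : nat) (F G : nat -> nat -> nat -> V) :
  (forall i j k, (i < p)%N -> (j < p)%N -> (k < p)%N -> F i j k = G i j k) ->
  sum3 p m F = sum3 p m G.
Proof. by move=> eFG; do 3!apply: eq_bigr => ? _; exact: eFG. Qed.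

Lemma sum3B (V : zmodType) (p m : nat) (F G : nat -> nat -> nat -> V) :
  sum3 p m F - sum3 p m G = sum3 p m (fun i j k => F i j k - G i j k).
Proof. by rewrite /sum3; do 3!(rewrite -sumrB; apply: eq_bigr => ? _). Qed.

Lemma sum3_swap23 (V : zmodType) (p m : nat) (F : nat -> nat -> nat -> V) :
  sum3 p m F = sum3 p m (fun i k j => F i j k).
Proof.
apply: eq_bigr => i _; rewrite (exchange_big_dep xpredT) //=.
by apply: eq_bigr => j _; apply: eq_bigl => k; rewrite addnAC.
Qed.

(** * Coefficients of the two deformation identities *)

Section Coefficients.
Variables (K : fieldType) (A : lmodType K).
Implicit Types (N : nat -> A -> A -> A) (M : nat -> A -> A).

Definition coef_nu N M (p m : nat) (a b c : A) : A :=
  sum3 p m (fun i j k => circ (N i) (M j) (N k) a b c)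
  - sum3 p m (fun i j k => circ (N i) (M j) (N k) b a c).

Definition coef_alpha N M (p m : nat) (a b : A) : A :=
  sum3 p m (fun i j k => N i (M j a) (M k b))
  - sum2 p m (fun i j => M i (N j a b)).

(** The only trace of linearity that the passage from series to coefficients
    uses: the zero coefficients of a constant series contribute nothing. *)
Definition preserves0 N M : Prop :=
  [/\ forall i a, N i a 0 = 0, forall i b, N i 0 b = 0 & forall i, M i 0 = 0].

Lemma series_app1_const N M a m :
  preserves0 N M -> series_app1 M (const_series a) m = M m a.
Proof.
case=> _ _ M0; rewrite /series_app1 big_ord_recr /= [X in X + _]big1 => [|i _].
  by rewrite add0r (sum_saturated _ (fun j => M m (const_series a j))).
apply: big1 => j /eqP ijm; rewrite /const_series; case: eqP => [j0|_ //].
by have := ltn_ord i; rewrite -[X in (_ < X)%N]ijm j0 addn0 ltnn.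
Qed.

Lemma series_app2_const N M a b m :
  preserves0 N M ->
  series_app2 N (const_series a) (const_series b) m = N m a b.
Proof.
case=> Nr Nl _; rewrite /series_app2.
have inner (i : 'I_m.+1) : \sum_(j < m.+1) \sum_(k < m.+1 | (i + j + k == m)%N)
      N i (const_series a j) (const_series b k)
    = \sum_(k < m.+1 | (i + k == m)%N) N i a (const_series b k).
  rewrite big_ord_recl /= addn0 [X in _ + X]big1 ?addr0 // => j _.
  by apply: big1 => k _; exact: Nl.
under eq_bigr => i _ do rewrite inner.
rewrite big_ord_recr /= [X in X + _]big1 => [|i _].
  by rewrite add0r (sum_saturated _ (fun j => N m a (const_series b j))).
apply: big1 => j /eqP ijm; rewrite /const_series; case: eqP => [j0|_ //].
by have := ltn_ord i; rewrite -[X in (_ < X)%N]ijm j0 addn0 ltnn.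
Qed.

(** The arguments of the identities are constant series, on which nu_t and
    alpha_t act coefficientwise; only the outer application of a series
    produces a convolution. *)
Lemma hom_pre_lie_modP N M (p : nat) :
  preserves0 N M ->
  hom_pre_lie_mod p N M <->
  forall m, (m < p)%N ->
    (forall a b c, coef_nu N M m.+1 m a b c = 0)
    /\ (forall a b, coef_alpha N M m.+1 m a b = 0).
Proof.
move=> NM0.
have E1 a m := series_app1_const a m NM0.
have E2 a b m := series_app2_const a b m NM0.
have assocE a b c m :
    series_sub
      (series_app2 N (series_app2 N (const_series a) (const_series b))
                     (series_app1 M (const_series c)))
      (series_app2 N (series_app1 M (const_series a))
                     (series_app2 N (const_series b) (const_series c))) m
    = sum3 m.+1 m (fun i j k => circ (N i) (M j) (N k) a b c).
  (* The first term of circ carries its factors in the order nu, alpha, nu,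
     whereas nu_t applied to (nu_t(a, b), alpha_t(c)) produces them in the order
     nu, nu, alpha. *)
  rewrite /circ -sum3B (sum3_swap23 _ _ (fun i j k => N i (N k a b) (M j c))).
  by congr (_ - _); do 3!apply: eq_bigr => ? _; rewrite ?E1 ?E2.
have multE a b m :
    (series_app2 N (series_app1 M (const_series a))
                   (series_app1 M (const_series b)) m
     = sum3 m.+1 m (fun i j k => N i (M j a) (M k b)))
    * (series_app1 M (series_app2 N (const_series a) (const_series b)) m
     = sum2 m.+1 m (fun i j => M i (N j a b))).
  by split; [do 3!apply: eq_bigr => ? _ | do 2!apply: eq_bigr => ? _];
    rewrite ?E1 ?E2.
split=> [[Hnu Halpha] m ltmp|H].
  split=> [a b c|a b]; apply/eqP; rewrite subr_eq0; apply/eqP.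
    by rewrite -!assocE; exact: Hnu.
  by rewrite -!multE; exact: Halpha.
split=> [a b c|a b] /= m ltmp; have [Hnu Halpha] := H m ltmp.
  by rewrite !assocE; apply/eqP; rewrite -subr_eq0; apply/eqP; exact: Hnu.
by rewrite !multE; apply/eqP; rewrite -subr_eq0; apply/eqP; exact: Halpha.
Qed.

Lemma eq_coef N N' M M' (p m : nat) :
  (forall i, (i < p)%N -> N i =2 N' i) -> (forall i, (i < p)%N -> M i =1 M' i) ->
  (forall a b c, coef_nu N M p m a b c = coef_nu N' M' p m a b c)
  /\ (forall a b, coef_alpha N M p m a b = coef_alpha N' M' p m a b).
Proof.
move=> eN eM; split=> [a b c|a b]; congr (_ - _).
- by apply: eq_sum3 => i j k *; rewrite /circ !eN // !eM.
- by apply: eq_sum3 => i j k *; rewrite /circ !eN // !eM.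
- by apply: eq_sum3 => i j k *; rewrite !eN // !eM.
- by apply: eq_sum2 => i j *; rewrite !eN // !eM.
Qed.

End Coefficients.

(** * One-step extension of a deformation *)

Section Extension.
Variables (K : fieldType) (A : lmodType K) (n : nat).
Variables (nu_ : 'I_n.+1 -> {bilinear A -> A -> A}).
Variables (alpha_ : 'I_n.+1 -> {linear A -> A}).

Lemma poly_series_ord :
  (forall i : 'I_n.+1, poly_series2 nu_ i =2 nu_ i)
  /\ (forall i : 'I_n.+1, poly_series1 alpha_ i =1 alpha_ i).
Proof.
by split=> i => [a b|a]; rewrite /poly_series1 /poly_series2 (big_pred1 i).
Qed.

Lemma poly_series_over :
  (forall a b, poly_series2 nu_ n.+1 a b = 0)
  * (forall a, poly_series1 alpha_ n.+1 a = 0).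
Proof.
by split=> *; rewrite /poly_series1 /poly_series2 big_pred0 // => i;
  rewrite ltn_eqF.
Qed.

Lemma poly_series_preserves0 :
  preserves0 (poly_series2 nu_) (poly_series1 alpha_).
Proof.
split=> *; rewrite /poly_series1 /poly_series2 big1 // => i _.
- by rewrite linear0r.
- by rewrite linear0l.
- by rewrite linear0.
Qed.

Variables (nu' : {bilinear A -> A -> A}) (alpha' : {linear A -> A}).
Let N' := add_term2 (poly_series2 nu_) n.+1 nu'.
Let M' := add_term1 (poly_series1 alpha_) n.+1 alpha'.

Lemma add_term_below :
  (forall i, (i < n.+1)%N -> N' i =2 poly_series2 nu_ i)
  /\ (forall i, (i < n.+1)%N -> M' i =1 poly_series1 alpha_ i).
Proof.
by split=> i lti => [a b|a];
  rewrite /N' /M' /add_term2 /add_term1 ltn_eqF // addr0.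
Qed.

Lemma add_term_top : (N' n.+1 =2 nu') * (M' n.+1 =1 alpha').
Proof.
by split=> [a b|a];
  rewrite /N' /M' /add_term2 /add_term1 eqxx poly_series_over add0r.
Qed.

Lemma add_term_preserves0 : preserves0 N' M'.
Proof.
have [Nr Nl M0] := poly_series_preserves0.
by split=> i *; rewrite /N' /M' /add_term2 /add_term1 ?Nr ?Nl ?M0 add0r;
  case: eqP => // _; rewrite ?linear0r ?linear0l ?linear0.
Qed.

Variables (nu : {bilinear A -> A -> A}) (alpha : {linear A -> A}).
Hypotheses (nu_0 : nu_ ord0 =2 nu) (alpha_0 : alpha_ ord0 =1 alpha).

(** The coefficient of degree n + 1 is affine in (nu', alpha'): its constant
    part comes from the indices at most n, its linear part from the boundary
    terms, which are the summands of the differential with opposite sign. *)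
Lemma top_coef :
  (forall a b c, coef_nu N' M' n.+2 n.+1 a b c
     = obstruction_nu nu_ alpha_ a b c - d_nu nu alpha nu' alpha' a b c)
  /\ (forall a b, coef_alpha N' M' n.+2 n.+1 a b
     = obstruction_alpha nu_ alpha_ a b - d_alpha nu alpha nu' alpha' a b).
Proof.
have [eN eM] := add_term_below; have [pN pM] := poly_series_ord.
have oN (i : 'I_n.+1) a b : N' i a b = nu_ i a b by rewrite eN ?pN.
have oM (i : 'I_n.+1) a : M' i a = alpha_ i a by rewrite eM ?pM.
have N0 a b : N' 0 a b = nu a b by rewrite (oN ord0) nu_0.
have M0 a : M' 0 a = alpha a by rewrite (oM ord0) alpha_0.
split=> [a b c|a b].
  have low x y z : sum3 n.+1 n.+1 (fun i j k => circ (N' i) (M' j) (N' k) x y z)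
      = \sum_(i < n.+1) \sum_(j < n.+1) \sum_(k < n.+1 | (i + j + k == n.+1)%N)
          circ (nu_ i) (alpha_ j) (nu_ k) x y z.
    by do 3!apply: eq_bigr => ? _; rewrite /circ !oN !oM.
  rewrite /coef_nu !sum3_last_layer !low /circ !(N0, M0, add_term_top).
  rewrite /obstruction_nu /d_nu /d_nunu /d_alphanu.
  rewrite !(opprD, opprK, addrA).
  by rewrite [LHS](ACl (1*8*3*10*9*2*14*7*6*13*12*5*4*11)).
have low3 : sum3 n.+1 n.+1 (fun i j k => N' i (M' j a) (M' k b))
    = \sum_(i < n.+1) \sum_(j < n.+1) \sum_(k < n.+1 | (i + j + k == n.+1)%N)
        nu_ i (alpha_ j a) (alpha_ k b).
  by do 3!apply: eq_bigr => ? _; rewrite !oN !oM.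
have low2 : sum2 n.+1 n.+1 (fun i j => M' i (N' j a b))
    = \sum_(i < n.+1) \sum_(j < n.+1 | (i + j == n.+1)%N) alpha_ i (nu_ j a b).
  by do 2!apply: eq_bigr => ? _; rewrite !oN !oM.
rewrite /coef_alpha sum3_last_layer sum2_last_layer low3 low2.
rewrite !(N0, M0, add_term_top).
rewrite /obstruction_alpha /d_alpha /d_nualpha /d_alphaalpha.
rewrite !(opprD, opprK, addrA).
by rewrite [LHS](ACl (1*5*6*4*2*3*7)).
Qed.

End Extension.

Unset Implicit Arguments.

Theorem theorem3p5 (K : fieldType) (charK : [pchar K] =i pred0)
    (A : lmodType K) (nu : {bilinear A -> A -> A}) (alpha : {linear A -> A})
    (HA : is_regular_hom_pre_lie nu alpha)
    (n : nat)
    (nu_ : 'I_n.+1 -> {bilinear A -> A -> A})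
    (alpha_ : 'I_n.+1 -> {linear A -> A})
    (Hdef : is_deformation nu alpha nu_ alpha_) :
  is_extendable nu_ alpha_ <->
  class_vanishes nu alpha (obstruction nu_ alpha_).
Proof.
have [nu_0 alpha_0 def_n] := Hdef.
have coef_n := (hom_pre_lie_modP _ (poly_series_preserves0 nu_ alpha_)).1 def_n.
split=> [[nu' [alpha' ext]]|[[nu' alpha'] [/= Onu Oalpha]]].
  have [Tnu Talpha] := top_coef nu' alpha' nu_0 alpha_0.
  have [Cnu Calpha] := (hom_pre_lie_modP _
    (add_term_preserves0 nu_ alpha_ nu' alpha')).1 ext n.+1 (ltnSn _).
  exists (nu', alpha'); split=> [a b c|a b] /=; apply/eqP; rewrite -subr_eq0.
    by rewrite -Tnu Cnu.
  by rewrite -Talpha Calpha.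
(* In degree n + 1 the coboundary cancels the obstruction; in lower degrees the
   coefficients are those of the given deformation. *)
exists nu', alpha'; apply/hom_pre_lie_modP => [|m].
  exact: add_term_preserves0.
rewrite ltnS leq_eqVlt => /orP[/eqP->|ltmn].
  have [Tnu Talpha] := top_coef nu' alpha' nu_0 alpha_0.
  by split=> *; rewrite ?Tnu ?Talpha ?Onu ?Oalpha subrr.
have [eN eM] := add_term_below nu_ alpha_ nu' alpha'.
have [eCnu eCalpha] := eq_coef m
  (fun i lti => eN i (leq_trans lti ltmn)) (fun i lti => eM i (leq_trans lti ltmn)).
have [Cnu Calpha] := coef_n m ltmn.
by split=> *; rewrite ?eCnu ?eCalpha ?Cnu ?Calpha.
Qed.
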